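(* Fix an imprecise probabilities tree with finite state space $\mathscr{X}$, and let $\overline{\mathrm{E}}_{\mathrm V}$ be the corresponding game-theoretic upper expectation. For any situation $s\in\mathscr{X}^{\ast}$ and any non-decreasing sequence $\{f_n\}_{n\in\mathbb{N}_0}$ of bounded below variables in $\overline{\mathscr{L}}_b(\Omega)$ that converges pointwise to a variable $f\in\overline{\mathscr{L}}_b(\Omega)$, we have that \[\overline{\mathrm{E}}_{\mathrm V}(f\vert s)=\lim_{n\to+\infty}\overline{\mathrm{E}}_{\mathrm V}(f_n\vert s).\]
   Context: Notation: $\mathbb{N}=\{1,2,\dots\}$, $\mathbb{N}_0=\mathbb{N}\cup\{0\}$, $\overline{\mathbb{R}}=\mathbb{R}\cup\{-\infty,+\infty\}$, with conventions $+\infty-\infty=-\infty+\infty=+\infty$, $0\cdot(\pm\infty)=0$, $\inf\emptyset=+\infty$. For a non-empty set $\mathscr{Y}$, $\overline{\mathscr{L}}(\mathscr{Y})$ is the set of all maps $\mathscr{Y}\to\overline{\mathbb{R}}$ and $\overline{\mathscr{L}}_b(\mathscr{Y})$ the subset of those bounded below by a real constant. Limits and inequalities of functions are pointwise. Local models: $\mathscr{X}$ is a finite non-empty set. $\mathscr{X}^{\ast}=\bigcup_{n\in\mathbb{N}_0}\mathscr{X}^n$ is the set of situations (finite strings, including the empty string $\Box$). An imprecise probabilities tree assigns to each $s\in\mathscr{X}^{\ast}$ a map $\overline{\mathrm{Q}}_s\colon\overline{\mathscr{L}}(\mathscr{X})\to\overline{\mathbb{R}}$ that is an upper expectation, i.e.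 satisfies: (E1) $\overline{\mathrm{Q}}_s(c)=c$ for all $c\in\mathbb{R}$; (E2) $\overline{\mathrm{Q}}_s(f+g)\le\overline{\mathrm{Q}}_s(f)+\overline{\mathrm{Q}}_s(g)$ for all $f,g\in\overline{\mathscr{L}}_b(\mathscr{X})$; (E3) $\overline{\mathrm{Q}}_s(\lambda f)=\lambda\overline{\mathrm{Q}}_s(f)$ for all real $\lambda>0$ and $f\in\overline{\mathscr{L}}_b(\mathscr{X})$; (E4) $f\le g\Rightarrow\overline{\mathrm{Q}}_s(f)\le\overline{\mathrm{Q}}_s(g)$ for all $f,g\in\overline{\mathscr{L}}_b(\mathscr{X})$; (E5) $\lim_n\overline{\mathrm{Q}}_s(f_n)=\overline{\mathrm{Q}}_s(\lim_n f_n)$ for every non-decreasing sequence $\{f_n\}_{n\in\mathbb{N}_0}$ of non-negative variables in $\overline{\mathscr{L}}_b(\mathscr{X})$. Global model: $\Omega=\mathscr{X}^{\mathbb{N}}$ is the set of paths; for $\omega\in\Omega$, $\omega^n\in\mathscr{X}^n$ is the string of its first $n$ values; $\Gamma(x_{1:n})=\{\omega\in\Omega:\omega^n=x_{1:n}\}$. For $g,h\colon\Omega\to\overline{\mathbb{R}}$, $g\ge_s h$ means $g(\omega)\ge h(\omega)$ for all $\omega\in\Gamma(s)$. A supermartingale is a map $\mathscr{M}\colon\mathscr{X}^{\ast}\to\overline{\mathbb{R}}$ with $\overline{\mathrm{Q}}_s(\mathscr{M}(s\,\cdot))\le\mathscr{M}(s)$ for all $s\in\mathscr{X}^{\ast}$,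 where $\mathscr{M}(s\,\cdot)\in\overline{\mathscr{L}}(\mathscr{X})$ is $x\mapsto\mathscr{M}(sx)$. $\overline{\mathbb{M}}_{\mathrm b}$ is the set of supermartingales bounded below by a real constant, and $\liminf\mathscr{M}(\omega)=\liminf_{n\to+\infty}\mathscr{M}(\omega^n)$. The game-theoretic upper expectation is, for all $f\colon\Omega\to\overline{\mathbb{R}}$ and $s\in\mathscr{X}^{\ast}$, \[\overline{\mathrm{E}}_{\mathrm V}(f\vert s)=\inf\{\mathscr{M}(s):\mathscr{M}\in\overline{\mathbb{M}}_{\mathrm b},\ \liminf\mathscr{M}\ge_s f\}.\] *)

(* Defs.v *)
From mathcomp Require Import all_boot all_order all_algebra.
From mathcomp Require Import all_classical all_reals all_analysis.

Set Implicit Arguments.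
Unset Strict Implicit.
Unset Printing Implicit Defensive.

Import Order.TTheory GRing.Theory Num.Theory.
Import numFieldNormedType.Exports.

Local Open Scope classical_set_scope.
Local Open Scope ring_scope.
Local Open Scope ereal_scope.

Definition bounded_below (R : realType) (T : Type) (f : T -> \bar R) : Prop :=
  exists c : R, forall t, c%:E <= f t.

(* [dual_adde] is the addition of extended reals for which
   +oo - oo = -oo + oo = +oo; [*] satisfies 0 * (+oo) = 0 * (-oo) = 0. *)
Record upper_expectation (R : realType) (X : finType)
    (Q : (X -> \bar R) -> \bar R) : Prop := UpperExpectation {
  upper_cst : forall c : R, Q (fun=> c%:E) = c%:E;
  upper_subadd : forall f g : X -> \bar R,
    bounded_below f -> bounded_below g ->
    Q (fun x => dual_adde (f x) (g x)) <= dual_adde (Q f) (Q g);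
  upper_homog : forall (l : R) (f : X -> \bar R),
    (0 < l)%R -> bounded_below f ->
    Q (fun x => l%:E * f x) = l%:E * Q f;
  upper_monotone : forall f g : X -> \bar R,
    bounded_below f -> bounded_below g ->
    (forall x, f x <= g x) -> Q f <= Q g;
  upper_continuous : forall f_ : nat -> X -> \bar R,
    (forall n, bounded_below (f_ n)) ->
    (forall n x, 0 <= f_ n x) ->
    (forall x, nondecreasing_seq (f_ ^~ x)) ->
    (fun n => Q (f_ n)) @ \oo --> Q (fun x => limn (f_ ^~ x))
}.

(* Situations are finite sequences over X, [::] being the initial one; the
   children of a situation s are the [rcons s x]. *)
Definition imprecise_probabilities_tree (R : realType) (X : finType)
    (Q : seq X -> (X -> \bar R) -> \bar R) : Prop :=
  forall s, upper_expectation (Q s).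

(* Paths are functions nat -> X, their successive states being w 0, w 1, ...;
   the situation formed by the first n states of w is thus [mkseq w n]. *)
Definition cylinder (X : finType) (s : seq X) : set (nat -> X) :=
  [set w | mkseq w (size s) = s].

Definition supermartingale (R : realType) (X : finType)
    (Q : seq X -> (X -> \bar R) -> \bar R) (M : seq X -> \bar R) : Prop :=
  forall s, Q s (fun x => M (rcons s x)) <= M s.

Definition liminf_path (R : realType) (X : finType)
    (M : seq X -> \bar R) (w : nat -> X) : \bar R :=
  limn_einf (fun n => M (mkseq w n)).

Definition game_upper_expectation (R : realType) (X : finType)
    (Q : seq X -> (X -> \bar R) -> \bar R)
    (f : (nat -> X) -> \bar R) (s : seq X) : \bar R :=
  ereal_inf [set M s | M in [set M : seq X -> \bar R |
    [/\ supermartingale Q M, bounded_below M &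
        forall w, cylinder s w -> f w <= liminf_path M w]]].

(* Main.v *)
(* After adding a constant we may assume [0 <= f_ n]. The process
   S u := sup_n E(f_n | u) is a supermartingale, by continuity of the local
   models along non-decreasing sequences. By Levy's zero-one law,
   f_n <= liminf E(f_n | .) except on the events
   {liminf E(f_n | .) < a < b < f_n} with a < b rational. Each of them is null,
   by an upcrossing argument: if its indicator can be hedged from every
   situation with initial capital K, then it can be with capital (a / b) * K. A
   countable sum of supermartingales gives one with arbitrarily small initial
   value which tends to +oo on all these events; adding it to S shows that
   E(f | s) <= S s + e. *)
Require Import Defs.
From mathcomp Require Import all_boot all_order all_algebra.
From mathcomp Require Import all_classical all_reals all_analysis.

Set Implicit Arguments.
Unset Strict Implicit.
Unset Printing Implicit Defensive.

Import Order.TTheory GRing.Theory Num.Theory.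
Import numFieldNormedType.Exports.

Local Open Scope classical_set_scope.
Local Open Scope ring_scope.
Local Open Scope ereal_scope.

(** * Limits inferior and rational separation in the extended reals *)

Section ExtendedReals.
Context {R : realType}.
Implicit Types (x y : \bar R) (u v : nat -> \bar R).

Lemma dual_adde_ge0E x y : 0 <= x -> 0 <= y -> dual_adde x y = x + y.
Proof. by case: x => [r||]; case: y => [r'||]. Qed.

Lemma dual_adde_finE x (r : R) : dual_adde x r%:E = r%:E + x.
Proof. by case: x => [r'||]//; rewrite /dual_adde/= addrC. Qed.

Lemma limn_einf_cst x : limn_einf (fun=> x) = x.
Proof. by have [->] := cvg_limn_einf_sup (cvg_cst x). Qed.

Lemma le_limn_einf_near u v N : (forall n, (N <= n)%N -> u n <= v n) ->
  limn_einf u <= limn_einf v.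
Proof.
move=> uv; rewrite !limn_einf_lim.
apply: lee_lim; [exact: is_cvg_einfs|exact: is_cvg_einfs|].
near=> n; apply: le_ereal_inf_tmp => _ [m /= nm <-].
apply: le_trans (uv m _); first by apply: ereal_inf_lbound; exists m.
by apply: leq_trans nm; near: n; exists N.
Unshelve. all: by end_near. Qed.

Lemma limn_einf_ge_near x u N : (forall n, (N <= n)%N -> x <= u n) ->
  x <= limn_einf u.
Proof. by move=> /(@le_limn_einf_near (fun=> x)); rewrite limn_einf_cst. Qed.

Lemma limn_einf_le_near x u N : (forall n, (N <= n)%N -> u n <= x) ->
  limn_einf u <= x.
Proof. by move=> /(@le_limn_einf_near _ (fun=> x)); rewrite limn_einf_cst. Qed.

(** Rational bounds keep the exceptional events countable in number, and a positive [a] puts the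
    factor [a / b] strictly between 0 and 1. *)
Lemma ge0_rat_between x y : 0 <= x -> x < y ->
  exists a b : rat, [/\ (0 < ratr a :> R)%R, (ratr a < ratr b :> R)%R,
    x < (ratr a)%:E & (ratr b)%:E < y].
Proof.
move=> x0 xy.
(* Here [x] is real, and an infinite [y] is replaced by [r + 1]. *)
have [r [r' [xr rr' r'y]]] : exists r r', [/\ x = r%:E, (r < r')%R & r'%:E <= y].
  case: x x0 xy => [r _| _|]; [|by rewrite ltNge leey|by rewrite leNgt ltNy0].
  case: y => [r'| |] ry.
  - by exists r, r'; split; rewrite ?lexx -?lte_fin.
  - by exists r, (r + 1)%R; split=> //; rewrite ?leey// ltrDl.
  - by move: ry; rewrite ltNge leNye.
have [a] := rat_in_itvoo rr'; rewrite in_itv/= => /andP[ra ar'].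
have [b] := rat_in_itvoo ar'; rewrite in_itv/= => /andP[ab br'].
exists a, b; split=> //.
- by apply: le_lt_trans ra; rewrite -lee_fin -xr.
- by rewrite xr lte_fin.
- by apply: lt_le_trans r'y; rewrite lte_fin.
Qed.

End ExtendedReals.

(** * Paths through situations and first hitting situations *)

Section Cylinders.
Context {X : finType}.
Implicit Types (s t u v : seq X) (w : nat -> X).

Lemma take_mkseq w m n : (m <= n)%N -> take m (mkseq w n) = mkseq w m.
Proof. by move=> mn; rewrite /mkseq -map_take take_iota (minn_idPl mn). Qed.

Lemma cylinder_prefix_mkseq t w n : cylinder t w -> (size t <= n)%N ->
  prefix t (mkseq w n).
Proof. by move=> tw tn; rewrite prefixE take_mkseq// tw. Qed.

Lemma prefix_mkseq_cylinder v w n : prefix v (mkseq w n) -> cylinder v w.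
Proof.
move=> vw; have := size_prefix vw; rewrite size_mkseq => vn.
by move: vw; rewrite prefixE take_mkseq// => /eqP.
Qed.

Lemma cylinder_prefix t v w : prefix t v -> cylinder v w -> cylinder t w.
Proof.
move=> tv vw; apply: (@prefix_mkseq_cylinder _ _ (size v)).
by rewrite (vw : mkseq w (size v) = v).
Qed.

(* Recursion on the reversed situation, whose head is the last state. *)
Fixpoint first_hit_rev (D : pred (seq X)) (r : seq X) : option (seq X) :=
  if (if r is _ :: r' then first_hit_rev D r' else None) is Some v then Some v
  else if D (rev r) then Some (rev r) else None.

(** The shortest prefix of [u] satisfying [D], since shorter prefixes are consulted first: a
    stopping time read along [u]. *)
Definition first_hit D u := first_hit_rev D (rev u).

Lemma first_hit_rcons D u x : first_hit D (rcons u x) =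
  if first_hit D u is Some v then Some v
  else if D (rcons u x) then Some (rcons u x) else None.
Proof. by rewrite /first_hit rev_rcons/= -rev_rcons revK. Qed.

Lemma first_hitP D u v : first_hit D u = Some v -> prefix v u /\ D v.
Proof.
elim/last_ind: u v => [|u x IH] v; first by rewrite /first_hit/=; case: ifP => // ? [<-].
rewrite first_hit_rcons; case: (first_hit D u) IH => [v'|_].
  by move=> /(_ _ erefl)[vu ?] [<-]; split=> //; exact: prefix_trans (prefix_rcons _ _).
by case: ifP => // Dux [<-]; split=> //; exact: prefix_refl.
Qed.

Lemma first_hit_None D u : first_hit D u = None -> D u = false.
Proof.
elim/last_ind: u => [|u x _]; first by rewrite /first_hit/=; case: ifP.
by rewrite first_hit_rcons; case: first_hit => //; case: ifP.
Qed.

Lemma first_hit_mkseq D w n m v : first_hit D (mkseq w n) = Some v ->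
  (n <= m)%N -> first_hit D (mkseq w m) = Some v.
Proof.
move=> wv; elim: m => [|m IH]; first by rewrite leqn0 => /eqP <-.
by rewrite leq_eqVlt ltnS => /predU1P[<-//|/IH]; rewrite mkseqS first_hit_rcons => ->.
Qed.

End Cylinders.

Section Tree.
Context {R : realType} {X : finType}.
Variable Q : seq X -> (X -> \bar R) -> \bar R.
Hypothesis X_gt0 : (0 < #|X|)%N.
Hypothesis treeQ : imprecise_probabilities_tree Q.
Implicit Types (s t u v : seq X) (w : nat -> X) (M T : seq X -> \bar R)
  (f g : (nat -> X) -> \bar R).

Local Notation E := (game_upper_expectation Q).

(** * Lower bounds for supermartingales and elementary properties of [E] *)

Lemma ge0_bounded_below S (h : S -> \bar R) : (forall x, 0 <= h x) -> bounded_below h.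
Proof. by move=> h0; exists 0%R. Qed.

(** A child of least value exists by finiteness. Monotonicity and [upper_cst] put every real below
    this value under [M u]; going through reals also handles the value +oo, on which [upper_cst] is
    silent. *)
Lemma le_supermartingale_child M u : supermartingale Q M -> bounded_below M ->
  exists x, M (rcons u x) <= M u.
Proof.
move=> Msup [c Mc]; have [x0 _] := card_gt0P X_gt0.
case: (@arg_minP _ _ X x0 xpredT (fun x => M (rcons u x)) isT) => x _ xmin.
exists x; have Qge (r : R) : r%:E <= M (rcons u x) -> r%:E <= M u.
  move=> rx; apply: le_trans (Msup u).
  rewrite -(upper_cst (treeQ u) r); apply: (upper_monotone (treeQ u)).
  - by exists r.
  - by exists c.
  - by move=> y; apply: le_trans (xmin y isT).
case: (M (rcons u x)) Qge => [r| |] Qge; [exact: Qge| |exact: leNye].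
rewrite leye_eq; apply/eqP/eqyP => r _; apply: Qge; exact: leey.
Qed.

(** Choosing from [u] onwards a child of no larger value gives a path through [u] along which [M]
    never exceeds [M u]. *)
Lemma supermartingale_ge_liminf M u (a : \bar R) :
  supermartingale Q M -> bounded_below M ->
  (forall w, cylinder u w -> a <= liminf_path M w) -> a <= M u.
Proof.
move=> Msup Mb aM; have [x0 _] := card_gt0P X_gt0.
have /choice[next nextP] : forall v, exists x, M (rcons v x) <= M v.
  by move=> v; exact: le_supermartingale_child.
(* [h] first spells out [u], then follows [next]; the default [x0] of [nth] is never reached. *)
pose h v := if (size v < size u)%N then nth x0 u (size v) else next v.
pose g n := iter n (fun v => rcons v (h v)) [::].
have gE n : mkseq (h \o g) n = g n by elim: n => // n IH; rewrite mkseqS IH.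
have g_small n : (n <= size u)%N -> g n = take n u.
  elim: n => [|n IH nu]; first by rewrite take0.
  rewrite (take_nth x0)// -IH 1?ltnW//= /h.
  by rewrite -/(g n) (IH (ltnW nu)) size_takel ?nu ?(ltnW nu).
have gM n : (size u <= n)%N -> size (g n) = n /\ M (g n) <= M u.
  elim: n => [|n IH].
    by rewrite leqn0 => /eqP/size0nil ->.
  rewrite leq_eqVlt ltnS => /predU1P[un|/[dup] un /IH[sn gn]].
    by rewrite g_small -?un// take_size.
  rewrite /= -/(g n) size_rcons sn; split=> //.
  by rewrite /h sn ltnNge un /=; exact: le_trans (nextP _) gn.
apply: le_trans (aM (h \o g) _) _.
  by rewrite /cylinder/= gE g_small// take_size.
by apply: (@limn_einf_le_near _ _ _ (size u)) => n un; rewrite gE; case: (gM _ un).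
Qed.

Lemma game_upper_expectation_ge (a : \bar R) f u :
  (forall w, cylinder u w -> a <= f w) -> a <= E f u.
Proof.
move=> af; apply: le_ereal_inf_tmp => _ [M [Msup Mb fM] <-].
by apply: supermartingale_ge_liminf => // w uw; exact: le_trans (af _ uw) (fM _ uw).
Qed.

Lemma game_upper_expectation_le M f u : supermartingale Q M -> bounded_below M ->
  (forall w, cylinder u w -> f w <= liminf_path M w) -> E f u <= M u.
Proof. by move=> Msup Mb fM; apply: ereal_inf_lbound; exists M. Qed.

Lemma le_game_upper_expectation f g u :
  (forall w, f w <= g w) -> E f u <= E g u.
Proof.
move=> fg; apply: le_ereal_inf_tmp => _ [M [Msup Mb gM] <-].
by apply: game_upper_expectation_le => // w uw; exact: le_trans (fg _) (gM _ uw).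
Qed.

(** A hedge [M] of [f] from [u] is also one from each child, so [E f] is below [M] at the children;
    apply [Q u] and take the infimum over [M]. *)
Lemma game_upper_expectation_supermartingale f :
  (forall w, 0 <= f w) -> supermartingale Q (E f).
Proof.
move=> f0 u; apply: le_ereal_inf_tmp => _ [M [Msup [c Mc] fM] <-].
apply: le_trans (Msup u); apply: (upper_monotone (treeQ u)).
- by apply: ge0_bounded_below => x; exact: game_upper_expectation_ge.
- by exists c.
- move=> x; apply: game_upper_expectation_le => //; first by exists c.
  by move=> w uxw; apply: fM; exact: cylinder_prefix (prefix_rcons _ _) uxw.
Qed.

(** * Hedging with nonnegative supermartingales *)

(** Unlike the infimum [E g t], the capital comes with an actual strategy; nonnegativity everywhere
    allows strategies to be rescaled, summed and glued. *)
Definition covers g t (r : \bar R) := exists T,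
  [/\ supermartingale Q T, forall u, 0 <= T u, T t <= r &
      forall w, cylinder t w -> g w <= liminf_path T w].

Lemma le_covers g t r r' : r <= r' -> covers g t r -> covers g t r'.
Proof. by move=> rr' [T [? ? Tr ?]]; exists T; split=> //; exact: le_trans rr'. Qed.

(** A hedge of a nonnegative [f] from [t] is nonnegative at every extension of [t]; elsewhere the
    value +oo preserves the supermartingale inequality. *)
Lemma covers_lt f t (a : \bar R) : (forall w, 0 <= f w) -> E f t < a ->
  exists2 r, r < a & covers f t r.
Proof.
move=> f0 /ereal_inf_lt[_ [M [Msup Mb fM] <-] Ma]; exists (M t) => //.
exists (fun u => if prefix t u then M u else +oo); split.
- move=> u; case: ifPn => tu; last exact: leey.
  apply: le_trans (Msup u); rewrite le_eqVlt; apply/orP; left; apply/eqP; congr (Q u).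
  by apply/funext => x; rewrite (prefix_trans tu (prefix_rcons _ _)).
- move=> u; case: ifPn => // tu; apply: supermartingale_ge_liminf => // w uw.
  exact: le_trans (f0 w) (fM _ (cylinder_prefix tu uw)).
- by rewrite prefix_refl.
- move=> w tw; apply: le_trans (fM w tw) _.
  by apply: (@le_limn_einf_near _ _ _ (size t)) => n tn; rewrite cylinder_prefix_mkseq.
Qed.

(** Follow [M] until [P] first holds at or after [t], then use the current capital to buy a strategy
    hedging [g] from there. *)
Lemma covers_switch g t M (P : seq X -> Prop) :
  supermartingale Q M -> (forall u, 0 <= M u) ->
  (forall v, P v -> covers g v (M v)) ->
  (forall w, cylinder t w -> (forall n, (size t <= n)%N -> ~ P (mkseq w n)) ->
     g w <= liminf_path M w) ->
  covers g t (M t).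
Proof.
move=> Msup M0 PM gM.
have /choice[W WP] : forall v, exists T, P v ->
    [/\ supermartingale Q T, forall u, 0 <= T u, T v <= M v &
        forall w, cylinder v w -> g w <= liminf_path T w].
  (* Where [P] fails the value of [W] is irrelevant; [M] is a placeholder. *)
  move=> v; have [/PM[T TP]|nPv] := pselect (P v); first by exists T.
  by exists M.
pose D v := prefix t v && `[< P v >].
have DP v : D v -> P v by move=> /andP[_ /asboolP].
pose N u := if first_hit D u is Some v then W v u else M u.
have N0 u : 0 <= N u.
  rewrite /N; case eqv : first_hit => [v|]//.
  by have [_ /DP/WP[]] := first_hitP eqv.
exists N; split=> //.
- move=> u; rewrite /N; under [fun x => _]eq_fun do rewrite first_hit_rcons.
  case eqv : first_hit => [v|].
    by have [_ /DP/WP[]] := first_hitP eqv.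
  apply: le_trans (Msup u); apply: (upper_monotone (treeQ u)).
  + apply: ge0_bounded_below => x; have := N0 (rcons u x).
    by rewrite /N first_hit_rcons eqv.
  + exact: ge0_bounded_below.
  (* At a switch the new strategy costs at most the capital available. *)
  + by move=> x; case: ifP => // /DP/WP[].
- rewrite /N; case eqv : first_hit => [v|]//.
  (* A hit recorded at [t] is both a prefix and an extension of [t]. *)
  have [vt /andP[tv /asboolP Pv]] := first_hitP eqv.
  suff <- : v = t by have [] := WP _ Pv.
  apply/eqP; move: (vt); rewrite prefixE take_oversize ?(size_prefix tv)//.
  by rewrite eq_sym.
- move=> w tw.
  have [[n [v eqv]]|nohit] :=
      pselect (exists n v, first_hit D (mkseq w n) = Some v).
    have [vw /DP/WP[_ _ _ gW]] := first_hitP eqv.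
    apply: le_trans (gW w (prefix_mkseq_cylinder vw)) _.
    apply: (@le_limn_einf_near _ _ _ n) => m nm.
    by rewrite /N (first_hit_mkseq eqv nm).
  have hitN n : first_hit D (mkseq w n) = None.
    case eqv : first_hit => [v|]//.
    by exfalso; apply: nohit; exists n, v.
  apply: le_trans (gM w tw _) _.
    move=> n tn Pn; have := first_hit_None (hitN n).
    by rewrite /D cylinder_prefix_mkseq//= (asboolT Pn).
  by apply: (@le_limn_einf_near _ _ _ 0%N) => n _; rewrite /N hitN.
Qed.

(** * Closure properties of supermartingales *)

Lemma supermartingale_cst (c : R) : supermartingale Q (fun=> c%:E).
Proof. by move=> u; rewrite (upper_cst (treeQ u)). Qed.

Lemma supermartingaleZ (l : R) M : (0 < l)%R -> bounded_below M ->
  supermartingale Q M -> supermartingale Q (fun u => l%:E * M u).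
Proof.
move=> l0 [c Mc] Msup u; rewrite (upper_homog (treeQ u))//; last by exists c.
by rewrite lee_pmul2l// lte_fin.
Qed.

Lemma supermartingaleD_cst (c : R) M : bounded_below M ->
  supermartingale Q M -> supermartingale Q (fun u => c%:E + M u).
Proof.
move=> [b Mb] Msup u; under [fun x => _]eq_fun do rewrite -dual_adde_finE.
apply: le_trans (upper_subadd (treeQ u) _ _) _; [by exists b|by exists c|].
by rewrite (upper_cst (treeQ u)) dual_adde_finE leeD2l.
Qed.

Lemma supermartingaleD M T : (forall u, 0 <= M u) -> (forall u, 0 <= T u) ->
  supermartingale Q M -> supermartingale Q T ->
  supermartingale Q (fun u => M u + T u).
Proof.
move=> M0 T0 Msup Tsup u.
(* Opposite infinities cannot meet here, so the two additions agree. *)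
under [fun x => _]eq_fun do rewrite -dual_adde_ge0E//.
have Q0 N : (forall v, 0 <= N v) -> 0 <= Q u (fun x => N (rcons u x)).
  move=> N0; apply: (@le_trans _ _ (Q u (fun=> 0%:E))).
    by rewrite (upper_cst (treeQ u)).
  apply: (upper_monotone (treeQ u)) => //; first by exists 0%R.
  exact: ge0_bounded_below.
apply: le_trans (upper_subadd (treeQ u) _ _) _; try exact: ge0_bounded_below.
by rewrite dual_adde_ge0E ?Q0// leeD.
Qed.

(** The supremum is the limit of the sequence, and [upper_continuous] transfers the bounds for the
    individual terms to it. *)
Lemma supermartingale_sup (M_ : nat -> seq X -> \bar R) :
  (forall n u, 0 <= M_ n u) -> (forall u, nondecreasing_seq (M_ ^~ u)) ->
  (forall n, supermartingale Q (M_ n)) ->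
  supermartingale Q (fun u => ereal_sup (range (M_ ^~ u))).
Proof.
move=> M0 Mnd Msup u.
have limE v : ereal_sup (range (M_ ^~ v)) = limn (M_ ^~ v).
  by apply/esym/cvg_lim => //; exact: ereal_nondecreasing_cvgn.
under [fun x => _]eq_fun do rewrite limE.
have cvgQ := @upper_continuous _ _ _ (treeQ u) (fun n x => M_ n (rcons u x))
  (fun n => ge0_bounded_below (fun x => M0 n (rcons u x)))
  (fun n x => M0 n (rcons u x)) (fun x => Mnd (rcons u x)).
rewrite -(cvg_lim _ cvgQ)//; apply: lime_le; first by apply/cvg_ex; eexists; exact: cvgQ.
apply: nearW => n; apply: le_trans (Msup n u) _.
by apply: ereal_sup_ubound; exists n.
Qed.

Lemma supermartingale_series (T_ : nat -> seq X -> \bar R) :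
  (forall n u, 0 <= T_ n u) -> (forall n, supermartingale Q (T_ n)) ->
  supermartingale Q (fun u => \sum_(0 <= n <oo) T_ n u).
Proof.
move=> T0 Tsup; pose S n u := \sum_(0 <= k < n) T_ k u.
have Snd u : nondecreasing_seq (S ^~ u).
  by apply: ereal_nondecreasing_series => n _ _; exact: T0.
have SE u : \sum_(0 <= n <oo) T_ n u = ereal_sup (range (S ^~ u)).
  by apply/cvg_lim => //; exact: (ereal_nondecreasing_cvgn (Snd u)).
have S0 n u : 0 <= S n u by exact: sume_ge0.
rewrite (_ : (fun u => _) = (fun u => ereal_sup (range (S ^~ u)))); last first.
  by apply/funext => u; rewrite SE.
apply: supermartingale_sup => //.
elim=> [|n IH].
  rewrite (_ : S 0%N = (fun=> 0)); first exact: supermartingale_cst.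
  by apply/funext => u; rewrite /S big_geq.
rewrite (_ : S n.+1 = (fun u => S n u + T_ n u)); first exact: supermartingaleD.
by apply/funext => u; rewrite /S big_nat_recr.
Qed.

(** * Levy's zero-one law and its exceptional events *)

(* Buy a supermartingale starting below [a] and hedging [f], rescaled so that
   it is worth [K] when it exceeds [b]; if it never does, then [f <= b]. *)
Lemma covers_upcrossing f g (a b K : R) :
  (0 < a)%R -> (a < b)%R -> (0 < K)%R -> (forall w, 0 <= f w) ->
  (forall w, ~ (liminf_path (E f) w < a%:E /\ b%:E < f w) -> g w <= 0) ->
  (forall t, covers g t K%:E) -> forall t, covers g t (a / b * K)%:E.
Proof.
move=> a0 ab K0 f0 gA gK.
have b0 : (0 < b)%R by exact: lt_trans ab.
have Kb0 : (0 < K / b)%R by exact: divr_gt0.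
have below v : E f v < a%:E -> covers g v (a / b * K)%:E.
  move=> /(covers_lt f0)[r ra [M [Msup M0 Mr fM]]].
  apply: (@le_covers _ _ ((K / b)%:E * M v)).
    rewrite (_ : (a / b * K)%R = (K / b * a)%R); last by rewrite mulrC mulrA mulrAC.
    rewrite [leRHS]EFinM lee_pmul2l ?lte_fin//.
    by apply/ltW/(le_lt_trans Mr).
  (* Once [M] exceeds [b], the rescaled capital is at least [K], enough to continue with [gK]. *)
  apply: (@covers_switch _ _ (fun u => (K / b)%:E * M u) (fun u => b%:E < M u)).
  - by apply: supermartingaleZ => //; exact: ge0_bounded_below.
  - by move=> u; rewrite mule_ge0// lee_fin ltW.
  - move=> u bM; apply: le_covers (gK u).
    rewrite -[leLHS](_ : (K / b)%:E * b%:E = _); last by rewrite -EFinM divfK// gt_eqF.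
    by rewrite lee_pmul2l ?lte_fin// ltW.
  - move=> w vw nbM; apply: (@le_trans _ _ 0).
      apply: gA => -[_]; apply/negP; rewrite -leNgt.
      apply: le_trans (fM w vw) _.
      by apply: (@limn_einf_le_near _ _ _ (size v)) => n /nbM/negP; rewrite -leNgt.
    apply: (@limn_einf_ge_near _ _ _ 0%N) => n _.
    by rewrite mule_ge0// lee_fin ltW.
have abK0 : (0 <= a / b * K)%R by rewrite !mulr_ge0// ?invr_ge0 ltW.
(* The capital stays idle until [E f] drops below [a]; if it never does, the limit inferior is at
   least [a] and [g] is at most 0. *)
move=> t; apply: (@covers_switch _ _ (fun=> (a / b * K)%:E) (fun u => E f u < a%:E)) => //.
- exact: supermartingale_cst.
- move=> w tw naS; apply: (@le_trans _ _ 0); last first.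
    by apply: (@limn_einf_ge_near _ _ _ 0%N) => n _; rewrite lee_fin.
  apply: gA => -[+ _]; apply/negP; rewrite -leNgt.
  by apply: (@limn_einf_ge_near _ _ _ (size t)) => n /naS/negP; rewrite -leNgt.
Qed.

(** Each pass of the upcrossing argument multiplies the capital by [a / b < 1], at all situations at
    once; starting from the constant [m], finitely many passes reach [e]. *)
Lemma covers_levy f t (a b m e : R) :
  (0 < a)%R -> (a < b)%R -> (0 < m)%R -> (0 < e)%R -> (forall w, 0 <= f w) ->
  covers (fun w => if `[< liminf_path (E f) w < a%:E /\ b%:E < f w >]
    then m%:E else 0) t e%:E.
Proof.
move=> a0 ab m0 e0 f0; set g := (X in covers X).
have ab0 : (0 < a / b)%R by rewrite divr_gt0// (lt_trans a0).
have gk k : forall u, covers g u ((a / b) ^+ k * m)%:E.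
  elim: k => [u|k IH u].
    exists (fun=> m%:E); split=> //; first exact: supermartingale_cst.
    - by move=> _; rewrite lee_fin ltW.
    - by rewrite expr0 mul1r.
    - move=> w _; rewrite /liminf_path limn_einf_cst /g.
      by case: ifP => // _; rewrite lee_fin ltW.
  rewrite exprS -mulrA; apply: (covers_upcrossing _ _ _ f0) => //.
    by rewrite mulr_gt0// exprn_gt0.
  by move=> w nA; rewrite /g asboolF.
have [k ke] : exists k, ((a / b) ^+ k * m <= e)%R.
  have : (fun k => (a / b) ^+ k)%R @ \oo --> (0 : R)%R.
    apply: cvg_expr; rewrite gtr0_norm// ltr_pdivrMr ?mul1r//.
    exact: lt_trans ab.
  move=> /cvgrPdist_lt/(_ (e / m)%R (divr_gt0 e0 m0))[k _ /(_ k (leqnn k))] /=.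
  rewrite sub0r normrN gtr0_norm ?exprn_gt0// ltr_pdivlMr// => ke.
  by exists k; exact: ltW.
by apply: le_covers (gk k t); rewrite lee_fin.
Qed.

(** Payoffs of every size on every [A i] are bought at costs [e / 2 ^ k.+1], which sum to at most
    [e]. *)
Lemma covers_bigcup (I : countType) (A : I -> set (nat -> X)) t (e : R) :
  (0 < e)%R ->
  (forall i (m d : R), (0 < m)%R -> (0 < d)%R ->
     covers (fun w => if `[< A i w >] then m%:E else 0) t d%:E) ->
  covers (fun w => if `[< exists i, A i w >] then +oo else 0) t e%:E.
Proof.
move=> e0 cA.
(* The code [k] of [(n, i)] requests [n + 1] on [A i]; codes of no pair request nothing. *)
pose h k w : \bar R := if unpickle k is Some (n, i) then
  (if `[< A i w >] then n.+1%:R%:E else 0) else 0.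
have /choice[T TP] : forall k, exists T, [/\ supermartingale Q T, forall u, 0 <= T u,
    T t <= (e / (2 ^ k.+1)%:R)%:E & forall w, cylinder t w -> h k w <= liminf_path T w].
  move=> k; have d0 : (0 < e / (2 ^ k.+1)%:R)%R by rewrite divr_gt0// ltr0n expn_gt0.
  rewrite /h; case: unpickle => [[n i]|]; first exact: cA.
  exists (fun=> 0); split=> //; first exact: supermartingale_cst.
    by rewrite lee_fin ltW.
  by move=> w _; rewrite /liminf_path limn_einf_cst.
have T0 k u : 0 <= T k u by have [] := TP k.
exists (fun u => \sum_(0 <= k <oo) T k u); split.
- by apply: supermartingale_series => // k; have [] := TP k.
- by move=> u; apply: nneseries_ge0.
- apply: le_trans (epsilon_trick0 xpredT (ltW e0)).
  by apply: lee_nneseries => // k _; have [] := TP k.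
- move=> w tw; have TS k : liminf_path (T k) w <=
      liminf_path (fun u => \sum_(0 <= k <oo) T k u) w.
    apply: (@le_limn_einf_near _ _ _ 0%N) => n _.
    apply: le_trans (@nneseries_lim_ge _ _ xpredT 0%N k.+1 _) => //.
    by rewrite big_nat_recr//= leeDr// sume_ge0.
  case: asboolP => [[i Ai]|_]; last first.
    by apply: (@limn_einf_ge_near _ _ _ 0%N) => n _; exact: nneseries_ge0.
  (* The sum dominates its term coded by [(n, i)], and [n] is arbitrary. *)
  rewrite leye_eq; apply/eqP/eqyP => r r0.
  have [n rn] : exists n, (r <= n.+1%:R)%R.
    exists (Num.truncn r); exact/ltW/truncnS_gt.
  apply: le_trans (TS (pickle (n, i))).
  have [_ _ _ /(_ w tw)] := TP (pickle (n, i)); apply: le_trans.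
  by rewrite /h pickleK asboolT// lee_fin.
Qed.

(** * Continuity along non-decreasing sequences *)

Lemma game_upper_expectation_sup_ge0 (f_ : nat -> (nat -> X) -> \bar R) s :
  (forall n w, 0 <= f_ n w) -> (forall w, nondecreasing_seq (f_ ^~ w)) ->
  E (fun w => ereal_sup (range (f_ ^~ w))) s <= ereal_sup (range (fun n => E (f_ n) s)).
Proof.
move=> f0 fnd; pose S u := ereal_sup (range (fun n => E (f_ n) u)).
have ES n u : E (f_ n) u <= S u by apply: ereal_sup_ubound; exists n.
have E0 n u : 0 <= E (f_ n) u by exact: game_upper_expectation_ge.
have S0 u : 0 <= S u by exact: le_trans (ES 0%N u).
have Ssup : supermartingale Q S.
  apply: supermartingale_sup => //.
  - by move=> u m n mn; apply: le_game_upper_expectation => w; exact: fnd.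
  - by move=> n; exact: game_upper_expectation_supermartingale.
(* The conditions on the rationals belong to the event, so one countable type indexes all cases;
   where they fail the event is empty. *)
pose A (i : nat * (rat * rat)) : set (nat -> X) :=
  [set w | (0 < ratr i.2.1 :> R)%R /\ (ratr i.2.1 < ratr i.2.2 :> R)%R /\
    liminf_path (E (f_ i.1)) w < (ratr i.2.1)%:E /\ (ratr i.2.2)%:E < f_ i.1 w].
apply/lee_addgt0Pr => e e0.
have [|T [Tsup T0 Te AT]] := @covers_bigcup _ A s e e0.
  move=> [n [a b]] m d m0 d0.
  have [[a0 ab]|nab] := pselect ((0 < ratr a :> R)%R /\ (ratr a < ratr b :> R)%R).
    have [T [? ? ? AT]] := covers_levy s a0 ab m0 d0 (f0 n).
    exists T; split=> // w sw; apply: le_trans (AT w sw).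
    case: asboolP => [[_ [_ ?]]|_]; first by rewrite asboolT.
    by case: ifP => // _; rewrite lee_fin ltW.
  exists (fun=> 0); split=> //; first exact: supermartingale_cst.
    by rewrite lee_fin ltW.
  move=> w _; rewrite /liminf_path limn_einf_cst asboolF// => -[a0 [ab _]].
  by apply: nab.
apply: le_trans (_ : S s + T s <= _); last by rewrite leeD2l.
apply: (@game_upper_expectation_le (fun u => S u + T u)).
- exact: supermartingaleD.
- by apply: ge0_bounded_below => u; rewrite adde_ge0.
- move=> w sw; apply: ge_ereal_sup => _ [n _ <-].
  (* Either [T] tends to +oo along [w], or no rationals fit between the limit inferior of [E (f_ n)]
     and [f_ n w], and then [S] suffices. *)
  have [[i Ai]|nA] := pselect (exists i, A i w).
    have := AT w sw; rewrite asboolT; last by exists i.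
    move=> ooT; apply: le_trans (leey _) (le_trans ooT _).
    by apply: (@le_limn_einf_near _ _ _ 0%N) => k _; rewrite leeDr.
  apply: (@le_trans _ _ (liminf_path (E (f_ n)) w)).
    rewrite leNgt; apply/negP => /ge0_rat_between[|a [b [? ? ? ?]]].
      by apply: (@limn_einf_ge_near _ _ _ 0%N) => k _.
    by apply: nA; exists (n, (a, b)).
  apply: (@le_limn_einf_near _ _ _ 0%N) => k _.
  by apply: le_trans (ES n _) _; rewrite leeDl.
Qed.

(** Shifting hedges gives one inequality; the other is the same one applied to [- c] and [c + f]. *)
Lemma game_upper_expectationD_cst (c : R) f s :
  E (fun w => c%:E + f w) s = c%:E + E f s.
Proof.
have le (d : R) h : E (fun w => d%:E + h w) s <= d%:E + E h s.
  rewrite -leeBlDl//; apply: le_ereal_inf_tmp => _ [M [Msup [b Mb] hM] <-].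
  rewrite leeBlDl//.
  apply: (@game_upper_expectation_le (fun u => d%:E + M u)).
  - by apply: supermartingaleD_cst => //; exists b.
  - by exists (d + b)%R => u; rewrite EFinD leeD2l.
  - by move=> w sw; rewrite /liminf_path limn_einf_shift// leeD2l// hM.
apply/eqP; rewrite eq_le le/= -leeBrDl//.
rewrite [leRHS]addeC -EFinN; apply: le_trans (le (- c)%R (fun w => c%:E + f w)).
by apply: le_game_upper_expectation => w; rewrite addeA -EFinD addNr add0e.
Qed.

End Tree.

Theorem theorem23 (R : realType) (X : finType) (X_gt0 : (0 < #|X|)%N)
    (Q : seq X -> (X -> \bar R) -> \bar R)
    (treeQ : imprecise_probabilities_tree Q)
    (s : seq X) (f_ : nat -> (nat -> X) -> \bar R) (f : (nat -> X) -> \bar R)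
    (f_bounded : forall n, bounded_below (f_ n))
    (f_nondecreasing : forall w, nondecreasing_seq (f_ ^~ w))
    (f_cvg : forall w, f_ ^~ w @ \oo --> f w)
    (flim_bounded : bounded_below f) :
  (fun n => game_upper_expectation Q (f_ n) s) @ \oo
    --> game_upper_expectation Q f s.
Proof.
have [c fc] := f_bounded 0%N.
have fE w : f w = ereal_sup (range (f_ ^~ w)).
  rewrite -(cvg_lim _ (f_cvg w))//; apply/cvg_lim => //.
  exact: ereal_nondecreasing_cvgn.
have Emono : nondecreasing_seq (fun n => game_upper_expectation Q (f_ n) s).
  by move=> m n mn; apply: le_game_upper_expectation => w; exact: f_nondecreasing.
rewrite (_ : game_upper_expectation Q f s =
    ereal_sup (range (fun n => game_upper_expectation Q (f_ n) s))).
  exact: ereal_nondecreasing_cvgn.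
apply/eqP; rewrite eq_le; apply/andP; split; last first.
  apply: ge_ereal_sup => _ [n _ <-]; apply: le_game_upper_expectation => w.
  by rewrite fE; apply: ereal_sup_ubound; exists n.
(* [c] bounds [f_ 0] from below, hence every [f_ n] by monotonicity. *)
pose g n w := (- c)%:E + f_ n w.
have g0 n w : 0 <= g n w.
  rewrite /g addeC EFinN sube_ge0//; apply: le_trans (fc w) _.
  exact: f_nondecreasing.
have gnd w : nondecreasing_seq (g ^~ w).
  by move=> m n mn; rewrite leeD2l// f_nondecreasing.
have subcK x : c%:E + ((- c)%:E + x) = x by rewrite addeA -EFinD subrr add0e.
apply: (@le_trans _ _ (game_upper_expectation Q
    (fun w => c%:E + ereal_sup (range (g ^~ w))) s)).
  apply: le_game_upper_expectation => w; rewrite fE.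
  apply: ge_ereal_sup => _ [n _ <-]; rewrite -[leLHS]subcK leeD2l//.
  by apply: ereal_sup_ubound; exists n.
rewrite game_upper_expectationD_cst//.
rewrite -[leRHS]subcK leeD2l//.
apply: le_trans (game_upper_expectation_sup_ge0 X_gt0 treeQ s g0 gnd) _.
apply: ge_ereal_sup => _ [n _ <-]; rewrite game_upper_expectationD_cst// leeD2l//.
by apply: ereal_sup_ubound; exists n.
Qed.
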